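(* Let $(\bar x,\bar\lambda)=(\bar x^1,\dots,\bar x^N,\bar\lambda^1,\dots,\bar\lambda^N)\in S_{\rm KKT}(\bar p)$, and suppose that: (i) the SMFCQ holds at $(\bar p^k,\bar x^k,\bar\lambda^k)$ for each player $k$; (ii) the NEP satisfies the I-property at $(\bar p,\bar x,\bar\lambda)$ on $K(I_1,I_2)$. Then $S_{\rm KKT}$ is isolated calm at $\bar p$ for $(\bar x,\bar\lambda)$.
   Context: Nash equilibrium problem (NEP) with canonical perturbations. There are $N$ players; player $k$ has strategy $x^k\in\mathbb R^{n_k}$; $x=(x^1,\dots,x^N)\in\mathbb R^n$, $n=n_1+\cdots+n_N$; $x^{-k}$ denotes the other players' strategies. Parameters: $p^k=(u^k,v^k,w^k)\in\mathbb R^{m_k}\times\mathbb R^{n_k}\times\mathbb R^{d_k}$, $p=(p^1,\dots,p^N)$, identified with $(u,v,w)\in\mathbb R^{m}\times\mathbb R^n\times\mathbb R^d$, $m=\sum m_k$, $d=\sum d_k$. Given $x^{-k},p^k$, player $k$ solves $$\min_{x^k}\ f^k(x^k,x^{-k};w^k)-\langle v^k,x^k\rangle\ \text{ s.t. } g^k_i(x^k;w^k)=u^k_i\ (i=1,\dots,s_k),\ \ g^k_j(x^k;w^k)\le u^k_j\ (j=s_k+1,\dots,m_k),$$ with $f^k\in C^2(\mathbb R^n\times\mathbb R^{d_k})$, $g^k_i\in C^2(\mathbb R^{n_k}\times\mathbb R^{d_k})$. Lagrangian: $L^k(x^k,x^{-k},\lambda^k;w^k)=f^k(x^k,x^{-k};w^k)+\sum_{i=1}^{m_k}\lambda^k_ig^k_i(x^k;w^k)$.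 KKT mapping: $S_{\rm KKT}(p)$ is the set of $(x,\lambda)\in\mathbb R^n\times\mathbb R^m$ such that for each $k$: $v^k=\nabla_{x^k}L^k(x^k,x^{-k},\lambda^k;w^k)$; $g^k_i(x^k;w^k)=u^k_i$ for $i\le s_k$; and $\lambda^k_j\ge0$, $g^k_j(x^k;w^k)\le u^k_j$, $\lambda^k_j(g^k_j(x^k;w^k)-u^k_j)=0$ for $j>s_k$. Notation at $(\bar p,\bar x,\bar\lambda)\in{\rm gph}\,S_{\rm KKT}$: $\nabla^2_{x^kx^i}L^k\in\mathbb R^{n_k\times n_i}$ is the matrix of second partials $\partial^2L^k/\partial x^k_a\partial x^i_b$ evaluated at $(\bar x^k,\bar x^{-k},\bar\lambda^k;\bar w^k)$. Index sets: $I^k_1=\{1,\dots,s_k\}\cup\{i\in[s_k+1,m_k]:\bar\lambda^k_i>0=g^k_i(\bar x^k;\bar w^k)-\bar u^k_i\}$, $I^k_2=\{i\in[s_k+1,m_k]:\bar\lambda^k_i=0=g^k_i(\bar x^k;\bar w^k)-\bar u^k_i\}$. $K(I_1,I_2)=\{y=(y^1,\dots,y^N)\in\mathbb R^n:\nabla_{x^k}g^k_i(\bar x^k;\bar w^k)^{\mathrm T}y^k=0\ \forall i\in I^k_1,\ \nabla_{x^k}g^k_i(\bar x^k;\bar w^k)^{\mathrm T}y^k\le0\ \forall i\in I^k_2,\ k=1,\dots,N\}$. SMFCQ (strict Mangasarian–Fromovitz constraint qualification) for player $k$ at $(\bar p^k,\bar x^k,\bar\lambda^k)$: the vectors $\nabla_{x^k}g^k_i(\bar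 x^k;\bar w^k)$, $i\in I^k_1$, are linearly independent, and there is $z\in\mathbb R^{n_k}$ with $\nabla_{x^k}g^k_i(\bar x^k;\bar w^k)^{\mathrm T}z=0$ for all $i\in I^k_1$ and $<0$ for all $i\in I^k_2$. I-property at $(\bar p,\bar x,\bar\lambda)$ on $K(I_1,I_2)$: for any $y\in K(I_1,I_2)$, if $\sum_{i=1}^N(y^k)^{\mathrm T}\nabla^2_{x^kx^i}L^k\,y^i=0$ for every $k=1,\dots,N$, then $y=0$. A set-valued mapping $\Phi$ is isolated calm at $\bar a$ for $\bar b$ if $\bar b\in\Phi(\bar a)$ and there are $\kappa\ge0$ and open neighborhoods $U$ of $\bar a$, $V$ of $\bar b$ with $\Phi(a)\cap V\subset\{\bar b\}+\kappa\|a-\bar a\|\mathbb B$ for all $a\in U$, where $\mathbb B$ is the unit ball. *)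

(* Defs.v *)
From HB Require Import structures.
From mathcomp Require Import all_boot all_order all_algebra.
From mathcomp Require Import all_classical all_reals all_analysis.

Set Implicit Arguments.
Unset Strict Implicit.
Unset Printing Implicit Defensive.
Import Order.TTheory GRing.Theory Num.Theory.
Import numFieldNormedType.Exports.

Local Open Scope classical_set_scope.
Local Open Scope ring_scope.

Section Smoothness.
Context {R : realType} {V : normedModType R}.

(* For finite-dimensional V, the only case used below, continuity of
   x |-> 'd F x v for every v is continuity of x |-> 'd F x. *)
Definition C1 (F : V -> R) : Prop :=
  (forall x, differentiable F x) /\
  (forall v, continuous (fun x => 'd F x v)).

Definition C2 (F : V -> R) : Prop :=
  C1 F /\ (forall v, C1 (fun x => 'd F x v)).

End Smoothness.

Definition dot {R : realType} {n : nat} (u v : 'rV[R]_n) : R :=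
  \sum_(i < n) u ord0 i * v ord0 i.

(* nV and nW are the norms used in the estimate; the topologies are those of
   V and W. *)
Definition isolated_calm {R : realType} {V W : normedModType R}
    (nV : V -> R) (nW : W -> R) (Phi : V -> set W) (a : V) (b : W) : Prop :=
  Phi a b /\
  exists kappa : R, 0 <= kappa /\
  exists (A : set V) (B : set W),
    [/\ open A, A a, open B, B b &
      forall a', A a' ->
        Phi a' `&` B `<=` [set b' | nW (b' - b) <= kappa * nV (a' - a)]].

(* Player k has dimx k variables, ncst k constraints, the first neq k of which
   are equalities, and a parameter w^k of size dimw k.  A vector of R^n with
   n = n_1 + ... + n_N is a row vector of size \sum_k dimx k, its k-th block
   being submxrow x k; likewise for multipliers and parameters. *)
Record nep (R : realType) (N : nat) := Nep {
  dimx : 'I_N -> nat;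
  ncst : 'I_N -> nat;
  dimw : 'I_N -> nat;
  neq : 'I_N -> nat;
  neq_le : forall k, (neq k <= ncst k)%N;
  cost : forall k, 'rV[R]_(\sum_(i < N) dimx i) * 'rV[R]_(dimw k) -> R;
  cst : forall k, 'I_(ncst k) -> 'rV[R]_(dimx k) * 'rV[R]_(dimw k) -> R
}.

Section NEP.
Context {R : realType} {N : nat} (G : nep R N).

Definition profile : normedModType R := 'rV[R]_(\sum_(k < N) dimx G k).
Definition multiplier : normedModType R := 'rV[R]_(\sum_(k < N) ncst G k).
Definition wparam : normedModType R := 'rV[R]_(\sum_(k < N) dimw G k).

(* p = (u, v, w) *)
Definition param : normedModType R := (multiplier * profile * wparam)%type.
Definition solution : normedModType R := (profile * multiplier)%type.

Definition xpart (x : profile) (k : 'I_N) : 'rV[R]_(dimx G k) := submxrow x k.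
Definition mpart (l : multiplier) (k : 'I_N) : 'rV[R]_(ncst G k) :=
  submxrow l k.
Definition wpart (w : wparam) (k : 'I_N) : 'rV[R]_(dimw G k) := submxrow w k.

Definition pu (p : param) (k : 'I_N) : 'rV[R]_(ncst G k) := mpart p.1.1 k.
Definition pv (p : param) (k : 'I_N) : 'rV[R]_(dimx G k) := xpart p.1.2 k.
Definition pw (p : param) (k : 'I_N) : 'rV[R]_(dimw G k) := wpart p.2 k.

(* Euclidean norms: the library's norm on row vectors and on products is the
   max norm. *)
Definition param_norm (p : param) : R :=
  Num.sqrt (dot p.1.1 p.1.1 + dot p.1.2 p.1.2 + dot p.2 p.2).
Definition solution_norm (z : solution) : R :=
  Num.sqrt (dot z.1 z.1 + dot z.2 z.2).

Definition nep_C2 : Prop :=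
  (forall k, C2 (@cost R N G k)) /\ (forall k i, C2 (@cst R N G k i)).

Definition lagrangian (k : 'I_N) (lk : 'rV[R]_(ncst G k))
    (wk : 'rV[R]_(dimw G k)) (x : profile) : R :=
  cost (x, wk) + \sum_(i < ncst G k) lk ord0 i * cst i (xpart x k, wk).

(* canonical basis vector of R^n for the a-th coordinate of block k *)
Definition evec (k : 'I_N) (a : 'I_(dimx G k)) : profile :=
  delta_mx ord0 (tagnat.Rank k a).

Definition grad_lagrangian (k : 'I_N) (lk : 'rV[R]_(ncst G k))
    (wk : 'rV[R]_(dimw G k)) (x : profile) : 'rV[R]_(dimx G k) :=
  \row_a 'D_(evec a) (lagrangian lk wk) x.

Definition hess_lagrangian (k i : 'I_N) (lk : 'rV[R]_(ncst G k))
    (wk : 'rV[R]_(dimw G k)) (x : profile) : 'M[R]_(dimx G k, dimx G i) :=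
  \matrix_(a, b) 'D_(evec a) ('D_(evec b) (lagrangian lk wk)) x.

Definition grad_cst (k : 'I_N) (i : 'I_(ncst G k))
    (xk : 'rV[R]_(dimx G k)) (wk : 'rV[R]_(dimw G k)) : 'rV[R]_(dimx G k) :=
  \row_a 'D_(delta_mx ord0 a) (fun y => cst i (y, wk)) xk.

Definition SKKT (p : param) : set solution :=
  [set z | forall k : 'I_N,
    let x := z.1 in
    let lk := mpart z.2 k in
    let gu i := cst i (xpart x k, pw p k) - pu p k ord0 i in
    [/\ pv p k = grad_lagrangian lk (pw p k) x,
        forall i : 'I_(ncst G k), (i < neq G k)%N -> gu i = 0 &
        forall j : 'I_(ncst G k), (neq G k <= j)%N ->
          [/\ 0 <= lk ord0 j, gu j <= 0 & lk ord0 j * gu j = 0]]].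

Section Reference.
Variables (p : param) (x : profile) (l : multiplier).

Definition slack (k : 'I_N) (i : 'I_(ncst G k)) : R :=
  cst i (xpart x k, pw p k) - pu p k ord0 i.

Definition I1 (k : 'I_N) : {pred 'I_(ncst G k)} :=
  [pred i : 'I_(ncst G k) | (i < neq G k)%N ||
    [&& (neq G k <= i)%N, 0 < mpart l k ord0 i & slack i == 0]].

Definition I2 (k : 'I_N) : {pred 'I_(ncst G k)} :=
  [pred i : 'I_(ncst G k) |
    [&& (neq G k <= i)%N, mpart l k ord0 i == 0 & slack i == 0]].

Arguments I1 : clear implicits.
Arguments I2 : clear implicits.

Definition gradg (k : 'I_N) (i : 'I_(ncst G k)) : 'rV[R]_(dimx G k) :=
  grad_cst i (xpart x k) (pw p k).

Definition SMFCQ (k : 'I_N) : Prop :=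
  free [seq gradg i | i in I1 k] /\
  exists z : 'rV[R]_(dimx G k),
    (forall i, i \in I1 k -> dot (gradg i) z = 0) /\
    (forall i, i \in I2 k -> dot (gradg i) z < 0).

Definition critical_cone : set profile :=
  [set y | forall k : 'I_N,
    (forall i, i \in I1 k -> dot (gradg i) (xpart y k) = 0) /\
    (forall i, i \in I2 k -> dot (gradg i) (xpart y k) <= 0)].

Definition I_property : Prop :=
  forall y, critical_cone y ->
    (forall k : 'I_N,
      \sum_(i < N) xpart y k *m
        hess_lagrangian i (mpart l k) (pw p k) x *m (xpart y i)^T = 0) ->
    y = 0.

End Reference.
End NEP.

(* Main.v *)
(* Arguing by contradiction, take sequences p_n -> p and z_n = (x_n, l_n) -> (x, l)
   of KKT points with |z_n - z| > (n + 1) |p_n - p|, and divide by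
   t_n = |z_n - z|.  Along an ultrafilter the normalized increments of z_n
   converge to a unit vector (y, mu), while those of p_n vanish.  Passing to the
   limit in the KKT system shows that y is in the critical cone, that
   mu_i <grad g_i, y> = 0 for all i, and that Hess L y + sum_i mu_i grad g_i = 0
   blockwise.  Pairing the k-th block with y^k and using the symmetry of second
   derivatives, the I-property gives y = 0; then sum_i mu_i grad g_i = 0 with
   mu_i >= 0 on I_2, so pairing with the SMFCQ vector z kills mu on I_2 and
   linear independence kills it on I_1, contradicting |(y, mu)| = 1. *)

From Pilot Require Import Defs.
From HB Require Import structures.
From mathcomp Require Import all_boot all_order all_algebra.
From mathcomp Require Import all_classical all_reals all_analysis.
From mathcomp Require Import ring.
Import Order.TTheory GRing.Theory Num.Theory.
Import numFieldNormedType.Exports.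
Local Open Scope classical_set_scope.
Local Open Scope ring_scope.

(** * Differentials and symmetry of second derivatives *)

(** Directional derivatives see only the restriction to a line, so [f] and [g] may live on different
    spaces. This and [derive_line] turn a derivative in x with w frozen into a differential on the
    product space along a direction (v, 0). *)
Lemma derivable_line {R : numFieldType} {V V' W : normedModType R}
    (f : V -> W) (g : V' -> W) (x v : V) (x' v' : V') :
  (forall s : R, f (s *: v + x) = g (s *: v' + x')) ->
  derivable f x v = derivable g x' v'.
Proof.
move=> fg; have fg0 : f x = g x' by have := fg 0; rewrite !scale0r !add0r.
rewrite /derivable.
suff -> : (fun h : R => h^-1 *: ((f \o shift x) (h *: v) - f x)) =
  (fun h => h^-1 *: ((g \o shift x') (h *: v') - g x')) by [].
by apply/funext => h; rewrite /= fg fg0.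
Qed.

Lemma derive_line {R : numFieldType} {V V' W : normedModType R}
    (f : V -> W) (g : V' -> W) (x v : V) (x' v' : V') :
  (forall s : R, f (s *: v + x) = g (s *: v' + x')) ->
  'D_v f x = 'D_v' g x'.
Proof.
move=> fg; have fg0 : f x = g x' by have := fg 0; rewrite !scale0r !add0r.
rewrite /derive.
suff -> : (fun h : R => h^-1 *: ((f \o shift x) (h *: v) - f x)) =
  (fun h => h^-1 *: ((g \o shift x') (h *: v') - g x')) by [].
by apply/funext => h; rewrite /= fg fg0.
Qed.

Lemma line_is_derive {R : realType} {V : normedModType R} (f : V -> R)
    (c v : V) (s : R) :
  differentiable f (s *: v + c) ->
  is_derive s (1 : R) (fun r : R => f (r *: v + c)) ('d f (s *: v + c) v).
Proof.
move=> df.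
have line (r : R) : (fun r : R => f (r *: v + c)) (r *: 1 + s) =
    f (r *: v + (s *: v + c)).
  by rewrite /= scalerDl [r *: 1]mulr1 addrA.
apply: DeriveDef.
  by rewrite (derivable_line _ _ _ _ _ _ line); exact: diff_derivable.
by rewrite (derive_line _ _ _ _ _ _ line) deriveE.
Qed.

Lemma line_MVT {R : realType} {V : normedModType R} (f : V -> R) (c v : V)
    (h : R) :
  (forall z, differentiable f z) -> 0 < h ->
  exists2 s, s \in `]0, h[%R &
    f (h *: v + c) - f c = h * 'd f (s *: v + c) v.
Proof.
move=> df h0.
have cf : {within `[0, h], continuous (fun r : R => f (r *: v + c))}.
  apply: continuous_subspaceT => s; apply: differentiable_continuous.
  apply/derivable1_diffP.
  by have [] := line_is_derive f c v s (df _).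
have [s sI E] := MVT h0 (fun s _ => line_is_derive f c v s (df _)) cf.
by exists s => //; move: E; rewrite scale0r add0r subr0 mulrC.
Qed.

(** The mean value theorem is used twice: along [a] on the difference of [F] between two parallel
    segments, then along [b] on ['d F _ a]. The quotient is thereby exactly a second differential at
    a point near [x], and continuity concludes. *)
Lemma second_difference {R : realType} {V : normedModType R} (F : V -> R)
    (x a b : V) : C2 F ->
  (fun h : R => h ^- 2 * (F (h *: a + (h *: b + x)) - F (h *: a + x)
                          - (F (h *: b + x) - F x))) @ 0^'+
  --> 'd (fun z => 'd F z a) x b.
Proof.
move=> [[dF _] C2F]; have [dFa /(_ b x) cFab] := C2F a.
apply/cvgrPdist_lt => e e0.
move/cvgrPdist_lt : cFab => /(_ _ e0).
move=> /nbhs_ballP[d /= d0 dP].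
near=> h.
have h0 : 0 < h by near: h; exact: nbhs_right_gt.
pose g (r : R) := F (r *: a + (h *: b + x)) - F (r *: a + x).
pose dg (r : R) := 'd F (r *: a + (h *: b + x)) a - 'd F (r *: a + x) a.
have gD r : is_derive r (1 : R) g (dg r).
  apply: is_deriveB; exact: line_is_derive.
have cg : {within `[0, h], continuous g}.
  apply: continuous_subspaceT => r; apply: differentiable_continuous.
  by apply/derivable1_diffP; have [] := gD r.
have [s sI E1] := MVT h0 (fun r _ => gD r) cg.
have [t tI E2] := line_MVT (fun z => 'd F z a) (s *: a + x) b h dFa h0.
have -> : F (h *: a + (h *: b + x)) - F (h *: a + x) - (F (h *: b + x) - F x)
   = h ^+ 2 * 'd (fun z => 'd F z a) (t *: b + (s *: a + x)) b.
  move: E1; rewrite /g !scale0r !add0r subr0 => ->.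
  by rewrite expr2 -mulrA -E2 /dg mulrC; congr (_ * ('d F _ _ - _)); rewrite addrCA.
rewrite mulKf ?expf_neq0 ?gt_eqF//.
apply: dP; rewrite -ball_normE /= distrC addrA addrK.
move: sI tI; rewrite !in_itv /= => /andP[s0 sh] /andP[t0 th].
rewrite (le_lt_trans (ler_normD _ _))// !normrZ !gtr0_norm//.
(* The added 1 keeps the factor positive even when [a] and [b] are both 0, so that [h] can be taken
   below [d] divided by it. *)
apply: (@le_lt_trans _ _ (h * (`|a| + `|b| + 1))).
  rewrite !mulrDr mulr1 addrC -[leLHS]addr0; apply: lerD; last exact: ltW.
  by apply: lerD; apply: ler_wpM2r => //; exact: ltW.
rewrite -ltr_pdivlMr ?ltr_wpDl ?addr_ge0//.
near: h; apply: nbhs_right_lt; rewrite divr_gt0// ltr_wpDl ?addr_ge0//.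
Unshelve. all: by end_near. Qed.

(** The second difference is symmetric in [a] and [b], so the two second differentials are limits of
    one and the same function. *)
Lemma diff2_sym {R : realType} {V : normedModType R} (F : V -> R)
    (x a b : V) : C2 F ->
  'd (fun z => 'd F z a) x b = 'd (fun z => 'd F z b) x a.
Proof.
move=> C2F; have Fab := second_difference F x a b C2F.
have Fba := second_difference F x b a C2F.
suff E : (fun h : R => h ^- 2 * (F (h *: a + (h *: b + x)) - F (h *: a + x)
                          - (F (h *: b + x) - F x)))
    = (fun h : R => h ^- 2 * (F (h *: b + (h *: a + x))
  - F (h *: b + x) - (F (h *: a + x) - F x))).
  by rewrite E in Fab; exact: cvg_unique Fab Fba.
apply/funext => h; congr (_ * _); rewrite addrCA.
ring.
Qed.

(** * Limits along ultrafilters *)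

(** The quotient is ['d f a] applied to the quotient of the arguments, plus a remainder [o].
    Eventually [|s n - a| <= (|eta| + 1) t n], so the remainder estimate with tolerance
    [e / (|eta| + 1)] makes [o] at most [e]. *)
Lemma diff_quotient_cvg {R : realType} {V : normedModType R} {T : Type}
    (U : set_system T) {FU : ProperFilter U} (f : V -> R) (a eta : V)
    (s : T -> V) (t : T -> R) :
  differentiable f a -> (forall n, 0 < t n) -> s @ U --> a ->
  (fun n => (t n)^-1 *: (s n - a)) @ U --> eta ->
  (fun n => (t n)^-1 * (f (s n) - f a)) @ U --> 'd f a eta.
Proof.
move=> df t0 sa qeta.
have dc : continuous ('d f a) by exact: diff_continuous.
have lin : (fun n => 'd f a ((t n)^-1 *: (s n - a))) @ U --> 'd f a eta.
  exact: (cvg_comp _ _ qeta (dc eta)).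
rewrite -[X in _ --> X]addr0.
pose o n := (t n)^-1 * (f (s n) - f a - 'd f a (s n - a)).
rewrite (_ : (fun _ => _) = (fun n => 'd f a ((t n)^-1 *: (s n - a))) \+ o);
  last first.
  by apply/funext => n /=; rewrite /o linearZ /= -mulrDr subrKC.
apply: cvgD => //.
have /diff_locally/eqaddoP df0 := df.
have bq : \forall n \near U, `|(t n)^-1 *: (s n - a)| <= `|eta| + 1.
  move/cvgrPdist_le : qeta => /(_ 1 ltr01); apply: filterS => n qn.
  by rewrite -lerBlDl (le_trans (lerB_dist _ _))// distrC.
apply/cvgr0Pnorm_le => e e0.
have eta0 : 0 < `|eta| + 1 by rewrite ltr_wpDl.
have /df0 : 0 < e / (`|eta| + 1) by rewrite divr_gt0.
move=> /nbhs_ballP[d /= d0 dP].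
move/cvgrPdist_lt : sa => /(_ _ d0).
move: bq; apply: filterS2 => n bn dn.
have le : `|f (s n - a + a) - (f a + 'd f a (s n - a))|
    <= e / (`|eta| + 1) * `|s n - a|.
  by apply: dP; rewrite -ball_normE /= sub0r normrN distrC.
rewrite subrK opprD addrA in le; rewrite /o normrM gtr0_norm ?invr_gt0//.
rewrite -[leRHS](divfK (lt0r_neq0 eta0)).
move: bn; rewrite normrZ gtr0_norm ?invr_gt0// => bn.
have ti : 0 <= (t n)^-1 by rewrite invr_ge0 ltW.
apply: le_trans (ler_wpM2l ti le) _.
by rewrite [leLHS]mulrCA; apply: ler_wpM2l bn; apply: divr_ge0; exact: ltW.
Qed.

(** Compactness gives a cluster point, and an ultrafilter converges to each of its cluster points:
    it contains a set or its complement, and the complement of a neighborhood is excluded. This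
    takes the place of extracting subsequences. *)
Lemma ultra_compact_cvg {T : Type} {X : topologicalType} (U : set_system T)
    (f : T -> X) (A : set X) :
  UltraFilter U -> compact A -> (forall n, A (f n)) ->
  exists p : X, f @ U --> p.
Proof.
move=> UU cA fA; have UA : (f @ U) A by apply: filterE fA.
have [p [_ clp]] := cA (f @ U) _ UA.
exists p => B Bp; have [UB|UB] := in_ultra_setVsetC (f @^-1` B) UU; first exact: UB.
by have [z [nB /nB]] := clp (~` B) B UB Bp.
Qed.

Lemma unit_ball_compact {R : realType} (n : nat) :
  compact [set v : 'rV[R]_n | `|v| <= 1].
Proof.
apply: bounded_closed_compact.
  exists 1; split => // M M1 v /= v1; exact: le_trans v1 (ltW M1).
rewrite (_ : [set _ | _] = (fun v : 'rV[R]_n => `|v|) @^-1` [set r | r <= 1]) //.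
by apply: preimage_closed; [move=> v _; exact: norm_continuous | exact: closed_le].
Qed.

Lemma cvg_rVP {R : realType} {T : Type} (U : set_system T) {FU : Filter U}
    (n : nat) (f : T -> 'rV[R]_n) (c : 'rV[R]_n) :
  (forall j, (fun i => f i ord0 j) @ U --> c ord0 j) -> f @ U --> c.
Proof.
move=> fc; apply/cvgrPdist_le => e e0.
have : \forall i \near U, forall j : 'I_n, `|c ord0 j - f i ord0 j| <= e.
  apply: filter_forall => j; exact: (cvgrPdist_le _ _).1 (fc j) e e0.
apply: filterS => i H.
rewrite [leLHS]/Num.norm /= mx_normrE; apply: bigmax_le; first exact: ltW.
by move=> [a j] _ /=; rewrite ord1 !mxE.
Qed.

Lemma row_coord_cvg {R : realType} {T : Type} (U : set_system T) {FU : Filter U}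
    {n : nat} (f : T -> 'rV[R]_n) (c : 'rV[R]_n) (j : 'I_n) :
  f @ U --> c -> (fun i => f i ord0 j) @ U --> c ord0 j.
Proof.
by move=> fc; exact: (cvg_comp _ _ fc (@coord_continuous _ _ _ ord0 j c)).
Qed.

Lemma dot_cvg {R : realType} {T : Type} (U : set_system T) {FU : Filter U}
    {n : nat} (f : T -> 'rV[R]_n) (c : 'rV[R]_n) :
  f @ U --> c -> (fun i => dot (f i) (f i)) @ U --> dot c c.
Proof.
move=> fc; rewrite /dot; apply: cvg_big => [|j _].
  by move=> ?; exact: add_continuous.
by apply: cvgM; exact: row_coord_cvg fc.
Qed.

(** * Derivatives of the Lagrangians *)

Lemma submxrow_delta {R : nzRingType} {n : nat} {d : 'I_n -> nat} (k : 'I_n)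
    (a : 'I_(d k)) :
  submxrow (delta_mx ord0 (tagnat.Rank k a) : 'rV[R]_(\sum_i d i)) k
  = delta_mx ord0 a.
Proof.
apply/rowP => j; rewrite !mxE; congr ((_ && _)%:R).
apply/eqP/eqP => [/tagnat.rank_inj/eqP|-> //].
by rewrite -tag_eqE /tag_eq /= eqxx tagged_asE /= => /eqP.
Qed.

Lemma row_block_sum {R : nzRingType} {n : nat} {d : 'I_n -> nat}
    (v : 'rV[R]_(\sum_i d i)) :
  v = \sum_i \sum_(b < d i) submxrow v i ord0 b *:
        delta_mx ord0 (tagnat.Rank i b).
Proof.
rewrite sig_big_dep /= [LHS]row_sum_delta (reindex _ tagnat.rank_bij_on) /=.
by apply: eq_bigr => -[i b] _ /=; rewrite !mxE.
Qed.

Lemma submxrow_scale {R : nzRingType} {n : nat} {d : 'I_n -> nat} (s : R)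
    (v : 'rV[R]_(\sum_i d i)) (k : 'I_n) :
  submxrow (s *: v) k = s *: submxrow v k.
Proof. by apply/rowP => j; rewrite !mxE. Qed.

Lemma diff_pair0_linear {R : realType} {V W : normedModType R}
    (f : V * W -> R) (z : V * W) (s : R) (v w : V) :
  'd f z (s *: v + w, 0) = s * 'd f z (v, 0) + 'd f z (w, 0).
Proof.
have -> : (s *: v + w, 0) = s *: (v, 0) + (w, 0) :> V * W.
  by congr (_, _); rewrite /= scaler0 addr0.
exact: linearP.
Qed.

Section Lagrangian.
Context {R : realType} {N : nat} {G : nep R N}.
Variables (k : 'I_N) (lk : 'rV[R]_(ncst G k)) (wk : 'rV[R]_(dimw G k)).

(** A single formula serves for both orders of differentiation of the Lagrangian: [c] and [g] are
    first the cost and the constraints, then their differentials in a fixed direction. The zero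
    components express that w is frozen. *)
Definition weighted_diff (c : profile G * 'rV[R]_(dimw G k) -> R)
    (g : 'I_(ncst G k) -> 'rV[R]_(dimx G k) * 'rV[R]_(dimw G k) -> R)
    (x v : profile G) : R :=
  'd c (x, wk) (v, 0)
  + \sum_j lk ord0 j * 'd (g j) (xpart x k, wk) (xpart v k, 0).

Lemma weighted_diff_linear c g x :
  linear (weighted_diff c g x : profile G -> R^o).
Proof.
move=> s v w; rewrite /weighted_diff diff_pair0_linear.
have xpE : xpart (s *: v + w) k = s *: xpart v k + xpart w k.
  by rewrite -submxrow_scale -submxrowD.
rewrite xpE; under eq_bigr => j _ do rewrite diff_pair0_linear mulrDr mulrCA.
by rewrite big_split /= -mulr_sumr addrACA -mulrDr.
Qed.

Lemma derive_weighted_sum (c : profile G * 'rV[R]_(dimw G k) -> R)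
    (g : 'I_(ncst G k) -> 'rV[R]_(dimx G k) * 'rV[R]_(dimw G k) -> R)
    (x v : profile G) :
  (forall z, differentiable c z) -> (forall j z, differentiable (g j) z) ->
  is_derive x v
    (fun x => c (x, wk) + \sum_j lk ord0 j * g j (xpart x k, wk))
    (weighted_diff c g x v).
Proof.
move=> dc dg.
have cl (s : R) : c (s *: v + x, wk) = c (s *: (v, 0) + (x, wk)).
  by congr (c (_, _)); rewrite /= scaler0 add0r.
have gl j (s : R) : g j (xpart (s *: v + x) k, wk)
    = g j (s *: (xpart v k, 0) + (xpart x k, wk)).
  by congr (g j (_, _)); rewrite /= ?scaler0 ?add0r // -submxrow_scale -submxrowD.
have Dc : is_derive x v (fun x => c (x, wk)) ('d c (x, wk) (v, 0)).
  apply: DeriveDef.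
    by rewrite (derivable_line _ _ _ _ _ _ cl); exact: diff_derivable.
  by rewrite (derive_line _ _ _ _ _ _ cl) deriveE.
have Dg j : is_derive x v (fun x => g j (xpart x k, wk))
    ('d (g j) (xpart x k, wk) (xpart v k, 0)).
  apply: DeriveDef.
    by rewrite (derivable_line _ _ _ _ _ _ (gl j)); exact: diff_derivable.
  by rewrite (derive_line _ _ _ _ _ _ (gl j)) deriveE.
have Dlg j : is_derive x v (fun x => lk ord0 j * g j (xpart x k, wk))
    (lk ord0 j * 'd (g j) (xpart x k, wk) (xpart v k, 0)).
  exact: is_deriveZ.
have -> : (fun x => c (x, wk) + \sum_j lk ord0 j * g j (xpart x k, wk))
  = (fun x => c (x, wk)) + \sum_j (fun x => lk ord0 j * g j (xpart x k, wk)).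
  by apply/funext => z; rewrite fctE /= fct_sumE.
by apply: is_deriveD; exact: is_derive_sum.
Qed.

Definition lagrangian_diff (u x : profile G) : R :=
  weighted_diff (@cost R N G k) (fun j => @Defs.cst R N G k j) x u.

Definition lagrangian_diff2 (x u v : profile G) : R :=
  weighted_diff (fun z => 'd (@cost R N G k) z (u, 0))
    (fun j z => 'd (@Defs.cst R N G k j) z (xpart u k, 0)) x v.

Hypothesis C2G : nep_C2 G.

Lemma derive_lagrangian (u x : profile G) :
  'D_u (lagrangian lk wk) x = lagrangian_diff u x.
Proof.
have [C2c C2g] := C2G.
have D := derive_weighted_sum (@cost R N G k) (fun j => @Defs.cst R N G k j) x u
  (C2c k).1.1 (fun j => (C2g k j).1.1).
exact: (@derive_val _ _ _ _ _ _ _ D).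
Qed.

Lemma derive_lagrangian_diff (x u v : profile G) :
  'D_v (lagrangian_diff u) x = lagrangian_diff2 x u v.
Proof.
have [C2c C2g] := C2G.
have D := derive_weighted_sum (fun z => 'd (@cost R N G k) z (u, 0))
  (fun j z => 'd (@Defs.cst R N G k j) z (xpart u k, 0)) x v
  ((C2c k).2 _).1 (fun j => ((C2g k j).2 _).1).
exact: (@derive_val _ _ _ _ _ _ _ D).
Qed.

(** Each term is symmetric by [diff2_sym]. The exchange is needed because [hess_lagrangian]
    differentiates along [evec b] first, while linearizing the a-th gradient component
    differentiates along [evec a] first. *)
Lemma lagrangian_diff2C (x u v : profile G) :
  lagrangian_diff2 x u v = lagrangian_diff2 x v u.
Proof.
have [C2c C2g] := C2G.
congr (_ + _); first exact: (diff2_sym _ (x, wk) (u, 0) (v, 0) (C2c k)).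
apply: eq_bigr => j _; congr (_ * _).
exact: (diff2_sym _ (xpart x k, wk) (xpart u k, 0) (xpart v k, 0) (C2g k j)).
Qed.

Lemma lagrangian_diff2_sumr (x u v : profile G) :
  lagrangian_diff2 x u v
  = \sum_i \sum_(b < dimx G i) xpart v i ord0 b * lagrangian_diff2 x u (evec b).
Proof.
pose Q : {linear profile G -> R^o} := HB.pack (lagrangian_diff2 x u)
  (GRing.isLinear.Build _ _ _ _ _ (weighted_diff_linear _ _ x)).
transitivity (Q v) => //; rewrite [in LHS](row_block_sum v) linear_sum.
apply: eq_bigr => i _; rewrite linear_sum.
by apply: eq_bigr => b _; rewrite linearZ.
Qed.

Lemma hess_lagrangianE (x : profile G) (i : 'I_N) a b :
  hess_lagrangian i lk wk x a b
  = lagrangian_diff2 x (evec a) (evec b).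
Proof.
transitivity ('D_(evec a) (lagrangian_diff (evec b)) x).
  have -> : lagrangian_diff (evec b) = 'D_(evec b) (lagrangian lk wk).
    by apply/funext => z; rewrite derive_lagrangian.
  by rewrite mxE.
by rewrite lagrangian_diff2C; exact: derive_lagrangian_diff.
Qed.

(** Summing the blocks over i reassembles the full direction [y] by linearity in the second
    direction. The expression tested by the I-property thus becomes [y^k] paired with the derivative
    of player k's gradient along [y]. *)
Lemma hess_lagrangian_form (x y : profile G) :
  \sum_i xpart y k *m hess_lagrangian i lk wk x *m (xpart y i)^T
  = (\sum_(a < dimx G k) xpart y k ord0 a * lagrangian_diff2 x (evec a) y)%:M.
Proof.
apply/matrixP => r c; rewrite !ord1 summxE !mxE eqxx mulr1n.
under [RHS]eq_bigr => a _ do rewrite lagrangian_diff2_sumr mulr_sumr.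
rewrite [RHS]exchange_big /=; apply: eq_bigr => i _.
rewrite !mxE; under [RHS]eq_bigr => a _ do rewrite mulr_sumr.
rewrite [RHS]exchange_big /=; apply: eq_bigr => b _.
rewrite !mxE mulr_suml; apply: eq_bigr => a _.
by rewrite hess_lagrangianE -mulrA; congr (_ * _); exact: mulrC.
Qed.

Lemma grad_lagrangianE (x : profile G) a :
  grad_lagrangian lk wk x ord0 a = lagrangian_diff (evec a) x.
Proof. by rewrite mxE derive_lagrangian. Qed.

Lemma grad_cstE (j : 'I_(ncst G k)) (xk : 'rV[R]_(dimx G k)) a :
  grad_cst j xk wk ord0 a = 'd (@Defs.cst R N G k j) (xk, wk) (delta_mx ord0 a, 0).
Proof.
have dg z : differentiable (@Defs.cst R N G k j) z := (C2G.2 k j).1.1 z.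
rewrite mxE -deriveE //; apply: derive_line => s; congr (Defs.cst _ (_, _)).
by rewrite /= scaler0 add0r.
Qed.

Lemma dot_grad_cst (j : 'I_(ncst G k)) (xk v : 'rV[R]_(dimx G k)) :
  dot (grad_cst j xk wk) v = 'd (@Defs.cst R N G k j) (xk, wk) (v, 0).
Proof.
have lin : linear ((fun v => 'd (@Defs.cst R N G k j) (xk, wk) (v, 0))
    : 'rV[R]_(dimx G k) -> R^o).
  move=> s u w; exact: diff_pair0_linear.
pose Q : {linear 'rV[R]_(dimx G k) -> R^o} := HB.pack
  (fun v => 'd (@Defs.cst R N G k j) (xk, wk) (v, 0))
  (GRing.isLinear.Build _ _ _ _ _ lin).
transitivity (Q v) => //; rewrite [in RHS](row_sum_delta v) linear_sum.
by apply: eq_bigr => a _; rewrite linearZ grad_cstE [LHS]mulrC.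
Qed.

End Lagrangian.

(** * Linearization of the KKT system *)

Lemma submxrow_cvg {R : realType} {T : Type} (U : set_system T) {FU : Filter U}
    {n : nat} {d : 'I_n -> nat} (f : T -> 'rV[R]_(\sum_i d i))
    (c : 'rV[R]_(\sum_i d i)) (k : 'I_n) :
  f @ U --> c -> (fun i => submxrow (f i) k) @ U --> submxrow c k.
Proof.
move=> fc; apply: cvg_rVP => j; rewrite mxE.
under eq_fun do rewrite mxE.
exact: (cvg_comp _ _ fc (@coord_continuous _ _ _ ord0 _ c)).
Qed.

Lemma diff_quotient_pair_cvg {R : realType} {V W : normedModType R} {T : Type}
    (U : set_system T) {FU : ProperFilter U} (f : V * W -> R)
    (a eta : V) (b theta : W) (r : T -> V) (s : T -> W) (t : T -> R) :
  differentiable f (a, b) -> (forall n, 0 < t n) ->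
  r @ U --> a -> s @ U --> b ->
  (fun n => (t n)^-1 *: (r n - a)) @ U --> eta ->
  (fun n => (t n)^-1 *: (s n - b)) @ U --> theta ->
  (fun n => (t n)^-1 * (f (r n, s n) - f (a, b))) @ U
    --> 'd f (a, b) (eta, theta).
Proof.
move=> df t0 ra sb qr qs.
by apply: (diff_quotient_cvg U f (a, b) (eta, theta) (fun n => (r n, s n)));
  [| | exact: cvg_pair ra sb | exact: cvg_pair qr qs].
Qed.

(** Leibniz splitting: a b - a0 b0 = (a - a0) b + a0 (b - b0). *)
Lemma product_quotient_cvg {R : realType} {T : Type} (U : set_system T)
    {FU : ProperFilter U} (t a b : T -> R) (a0 b0 a' b' : R) :
  (fun n => (t n)^-1 * (a n - a0)) @ U --> a' -> b @ U --> b0 ->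
  (fun n => (t n)^-1 * (b n - b0)) @ U --> b' ->
  (fun n => (t n)^-1 * (a n * b n - a0 * b0)) @ U --> a' * b0 + a0 * b'.
Proof.
move=> qa cb qb.
suff -> : (fun n => (t n)^-1 * (a n * b n - a0 * b0))
  = (fun n => (t n)^-1 * (a n - a0) * b n + a0 * ((t n)^-1 * (b n - b0))).
  by apply: cvgD; apply: cvgM => //; exact: cvg_cst.
by apply/funext => n; ring.
Qed.

(** Here [m] is a multiplier and [s] its slack. A nonzero limit of one factor forces the other
    factor to vanish eventually, hence also its quotient. If both limits are 0, the quotients
    inherit the signs of [m] and [s], and their product is 0. *)
Lemma complementarity_limit {R : realType} {T : Type} (U : set_system T)
    {FU : ProperFilter U} (t m s : T -> R) (m0 s0 m' s' : R) :
  (forall n, 0 < t n) ->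
  (fun n => (t n)^-1 * (m n - m0)) @ U --> m' ->
  (fun n => (t n)^-1 * (s n - s0)) @ U --> s' ->
  m @ U --> m0 -> s @ U --> s0 ->
  (forall n, [/\ 0 <= m n, s n <= 0 & m n * s n = 0]) ->
  [/\ 0 <= m0, s0 <= 0 & m0 * s0 = 0] ->
  [/\ 0 < m0 -> s' = 0, s0 < 0 -> m' = 0,
      m0 = 0 -> s0 = 0 -> 0 <= m' /\ s' <= 0 & m' * s' = 0].
Proof.
move=> t0 qm qs cm cs ms [m0ge s0le ms0].
have s'0 : 0 < m0 -> s' = 0.
  move=> m0gt; have s00 : s0 = 0.
    by move/eqP: ms0; rewrite mulf_eq0 gt_eqF //= => /eqP.
  apply: (cvg_unique _ qs) => //; apply: cvg_near_cst.
  (* The tolerance [m0] itself suffices: [m n = 0] would put [m n] at distance exactly [m0]. *)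
  move/cvgrPdist_lt : cm => /(_ _ m0gt); apply: filterS => n mn.
  have [_ _ /eqP] := ms n; rewrite mulf_eq0 => /orP[/eqP mn0|/eqP ->].
    by move: mn; rewrite mn0 subr0 gtr0_norm // ltxx.
  by rewrite s00 subrr mulr0.
have m'0 : s0 < 0 -> m' = 0.
  move=> s0lt; have m00 : m0 = 0.
    by move/eqP: ms0; rewrite mulf_eq0 (lt_eqF s0lt) orbF => /eqP.
  apply: (cvg_unique _ qm) => //; apply: cvg_near_cst.
  have s0lt' : 0 < - s0 by rewrite oppr_gt0.
  move/cvgrPdist_lt : cs => /(_ _ s0lt'); apply: filterS => n sn.
  have [_ _ /eqP] := ms n; rewrite mulf_eq0 => /orP[/eqP ->|/eqP sn0].
    by rewrite m00 subrr mulr0.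
  by move: sn; rewrite sn0 subr0 ltr0_norm // ltxx.
have deg : m0 = 0 -> s0 = 0 -> [/\ 0 <= m', s' <= 0 & m' * s' = 0].
  move=> m00 s00; split.
  - apply: (cvgr_to_ge qm); apply: nearW => n; have [mn _ _] := ms n.
    by rewrite m00 subr0 mulr_ge0 // invr_ge0 ltW.
  - apply: (cvgr_to_le qs); apply: nearW => n; have [_ sn _] := ms n.
    by rewrite s00 subr0 mulr_ge0_le0 // invr_ge0 ltW.
  - apply: (cvg_unique _ (cvgM qm qs)) => //.
    apply: cvg_near_cst; apply: nearW => n; have [_ _ msn] := ms n.
    by rewrite /= m00 s00 !subr0 mulrACA msn mulr0.
split => //; first by move=> m00 s00; have [] := deg m00 s00.
move: m0ge; rewrite le_eqVlt => /orP[/eqP/esym m00|/s'0 ->]; last exact: mulr0.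
move: s0le; rewrite le_eqVlt => /orP[/eqP s00|/m'0 ->]; last exact: mul0r.
by have [] := deg m00 s00.
Qed.

(** Freeness concerns coefficients indexed by positions in a list; enumerating [A] transports it to
    coefficients indexed by [I], as multipliers are. *)
Lemma free_image_coef {K : fieldType} {vT : vectType K} {I : finType}
    (A : {pred I}) (f : I -> vT) (c : I -> K) :
  free [seq f i | i in A] -> \sum_(i in A) c i *: f i = 0 ->
  forall i, i \in A -> c i = 0.
Proof.
move=> fr0 s0 i iA; have /freeP fr : free (image_tuple f A) by [].
rewrite -(enum_rankK_in iA iA); apply: (fr (fun j => c (enum_val j))).
rewrite -[RHS]s0 [RHS]big_enum_val; apply: eq_bigr => j _; congr (_ *: _).
by rewrite nth_image.
Qed.

(** * First-order limits along a filter of KKT points *)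

Section Linearization.
Context {R : realType} {N : nat} {G : nep R N}.
Context {T : Type} (U : set_system T) {FU : ProperFilter U}.
Variables (p : param G) (x y : profile G) (l mu : multiplier G).
Variables (pp : T -> param G) (xx : T -> profile G) (ll : T -> multiplier G).
Variable t : T -> R.
Hypothesis C2G : nep_C2 G.
Hypothesis sol : SKKT p (x, l).
Hypothesis sols : forall n, SKKT (pp n) (xx n, ll n).
Hypothesis t0 : forall n, 0 < t n.
Hypothesis cu : (fun n => (pp n).1.1) @ U --> p.1.1.
Hypothesis cw : (fun n => (pp n).2) @ U --> p.2.
Hypothesis cx : xx @ U --> x.
Hypothesis cl : ll @ U --> l.
Hypothesis qu :
  (fun n => (t n)^-1 *: ((pp n).1.1 - p.1.1)) @ U --> (0 : multiplier G).
Hypothesis qv :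
  (fun n => (t n)^-1 *: ((pp n).1.2 - p.1.2)) @ U --> (0 : profile G).
Hypothesis qw :
  (fun n => (t n)^-1 *: ((pp n).2 - p.2)) @ U --> (0 : wparam G).
Hypothesis qx : (fun n => (t n)^-1 *: (xx n - x)) @ U --> y.
Hypothesis ql : (fun n => (t n)^-1 *: (ll n - l)) @ U --> mu.

Lemma block_quotient_cvg {n : nat} {d : 'I_n -> nat}
    (f : T -> 'rV[R]_(\sum_i d i)) (c e : 'rV[R]_(\sum_i d i)) (k : 'I_n) :
  (fun i => (t i)^-1 *: (f i - c)) @ U --> e ->
  (fun i => (t i)^-1 *: (submxrow (f i) k - submxrow c k)) @ U
    --> submxrow e k.
Proof.
move=> /(submxrow_cvg U _ _ k).
by under eq_fun do rewrite submxrow_scale submxrowB.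
Qed.

Lemma block_diff_quotient_cvg (k : 'I_N)
    (f : 'rV[R]_(dimx G k) * 'rV[R]_(dimw G k) -> R) :
  (forall z, differentiable f z) ->
  (fun n => (t n)^-1 * (f (xpart (xx n) k, pw (pp n) k)
                        - f (xpart x k, pw p k))) @ U
    --> 'd f (xpart x k, pw p k) (xpart y k, 0).
Proof.
move=> df; apply: diff_quotient_pair_cvg => //.
- exact: submxrow_cvg.
- exact: submxrow_cvg.
- exact: block_quotient_cvg.
- by have := block_quotient_cvg _ _ _ k qw; rewrite submxrow0.
Qed.

(** The increments of [u] and [w] are negligible against [t], so only the derivative of the
    constraint along [y] survives. *)
Lemma slack_quotient_cvg (k : 'I_N) (i : 'I_(ncst G k)) :
  (fun n => (t n)^-1 * (slack (pp n) (xx n) i - slack p x i)) @ U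
    --> dot (gradg p x i) (xpart y k).
Proof.
have dg := (C2G.2 k i).1.1.
rewrite dot_grad_cst // -[X in _ --> X]subr0.
have := cvgB (block_diff_quotient_cvg k _ dg)
  (row_coord_cvg U _ _ i (block_quotient_cvg _ _ _ k qu)).
rewrite submxrow0 mxE.
suff -> : (fun n => (t n)^-1 * (slack (pp n) (xx n) i - slack p x i))
  = (fun n => (t n)^-1 * (Defs.cst i (xpart (xx n) k, pw (pp n) k)
                        - Defs.cst i (xpart x k, pw p k)) -
      ((t n)^-1 *: (submxrow (pp n).1.1 k - submxrow p.1.1 k)) ord0 i).
  by move=> H; exact: H.
by apply/funext => n; rewrite /slack /pu /mpart !mxE; ring.
Qed.

Lemma multiplier_quotient_cvg (k : 'I_N) (j : 'I_(ncst G k)) :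
  (fun n => (t n)^-1 * (mpart (ll n) k ord0 j - mpart l k ord0 j)) @ U
    --> mpart mu k ord0 j.
Proof.
suff -> : (fun n => (t n)^-1 * (mpart (ll n) k ord0 j - mpart l k ord0 j))
  = (fun n => ((t n)^-1 *: (submxrow (ll n) k - submxrow l k)) ord0 j).
  exact: (row_coord_cvg U _ _ j (block_quotient_cvg _ _ _ k ql)).
by apply/funext => n; rewrite /mpart !mxE.
Qed.

(** The equation [v^k = grad L^k] at the moving point minus the same at the reference point is
    divided by [t]. The left side tends to 0 by [qv]; on the right, the product rule separates the
    variation of the multipliers from that of the constraint derivatives. *)
Lemma stationarity_limit (k : 'I_N) (a : 'I_(dimx G k)) :
  lagrangian_diff2 k (mpart l k) (pw p k) x (evec a) y
  + \sum_j mpart mu k ord0 j * gradg p x j ord0 a = 0.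
Proof.
pose A z := 'd (@cost R N G k) z (evec a, 0).
pose B j z := 'd (@Defs.cst R N G k j) z (xpart (evec a) k, 0).
have dA z : differentiable A z := ((C2G.1 k).2 _).1 z.
have dB j z : differentiable (B j) z := ((C2G.2 k j).2 _).1 z.
have qA : (fun n => (t n)^-1 * (A (xx n, pw (pp n) k) - A (x, pw p k))) @ U
    --> 'd A (x, pw p k) (y, 0).
  apply: diff_quotient_pair_cvg => //; first exact: submxrow_cvg.
  by have := block_quotient_cvg _ _ _ k qw; rewrite submxrow0.
have cB j : (fun n => B j (xpart (xx n) k, pw (pp n) k)) @ U
    --> B j (xpart x k, pw p k).
  apply: (cvg_comp (fun n => (xpart (xx n) k, pw (pp n) k)) (B j)
    (cvg_pair (submxrow_cvg U _ _ k cx) (submxrow_cvg U _ _ k cw))).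
  exact: differentiable_continuous.
have qB j := block_diff_quotient_cvg k _ (dB j).
have qm := multiplier_quotient_cvg k.
have qlB j : (fun n => (t n)^-1 *
     (mpart (ll n) k ord0 j * B j (xpart (xx n) k, pw (pp n) k)
      - mpart l k ord0 j * B j (xpart x k, pw p k))) @ U
    --> mpart mu k ord0 j * B j (xpart x k, pw p k)
        + mpart l k ord0 j * 'd (B j) (xpart x k, pw p k) (xpart y k, 0).
  exact: product_quotient_cvg (qm j) (cB j) (qB j).
have qL : (fun n => (t n)^-1 * (A (xx n, pw (pp n) k) - A (x, pw p k))
   + \sum_j (t n)^-1 *
     (mpart (ll n) k ord0 j * B j (xpart (xx n) k, pw (pp n) k)
      - mpart l k ord0 j * B j (xpart x k, pw p k))) @ U
  --> 'd A (x, pw p k) (y, 0)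
     + \sum_j (mpart mu k ord0 j * B j (xpart x k, pw p k)
        + mpart l k ord0 j * 'd (B j) (xpart x k, pw p k) (xpart y k, 0)).
  apply: cvgD qA _; apply: cvg_big => [|j _]; last exact: qlB.
  exact: add_continuous.
have qv0 : (fun n => (t n)^-1 * (pv (pp n) k ord0 a - pv p k ord0 a)) @ U --> 0.
  suff -> : (fun n => (t n)^-1 * (pv (pp n) k ord0 a - pv p k ord0 a))
    = (fun n => ((t n)^-1 *: (submxrow (pp n).1.2 k - submxrow p.1.2 k)) ord0 a).
    have := row_coord_cvg U _ _ a (block_quotient_cvg _ _ _ k qv).
    by rewrite submxrow0 mxE => H; exact: H.
  by apply/funext => n; rewrite /pv /xpart !mxE.
have gradE q z m : SKKT q (z, m) -> pv q k ord0 a = A (z, pw q k)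
    + \sum_j mpart m k ord0 j * B j (xpart z k, pw q k).
  by move=> /(_ k)[-> _ _]; rewrite grad_lagrangianE.
have E : (fun n => (t n)^-1 * (pv (pp n) k ord0 a - pv p k ord0 a))
  = (fun n => (t n)^-1 * (A (xx n, pw (pp n) k) - A (x, pw p k))
   + \sum_j (t n)^-1 *
     (mpart (ll n) k ord0 j * B j (xpart (xx n) k, pw (pp n) k)
      - mpart l k ord0 j * B j (xpart x k, pw p k))).
  apply/funext => n; rewrite (gradE _ _ _ sol) (gradE _ _ _ (sols n)).
  by rewrite opprD addrACA mulrDr -sumrB mulr_sumr.
rewrite E in qv0; apply: etrans (esym (cvg_unique _ qv0 qL)) => //.
(* The terms weighted by [l] join the cost term to form [lagrangian_diff2]; those weighted by [mu]
   form the gradient sum. *)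
rewrite big_split /= [RHS]addrCA [RHS]addrC; congr (_ + _).
by apply: eq_bigr => j _; rewrite /gradg grad_cstE // -submxrow_delta.
Qed.

Lemma slack_cvg (k : 'I_N) (i : 'I_(ncst G k)) :
  (fun n => slack (pp n) (xx n) i) @ U --> slack p x i.
Proof.
have dg := differentiable_continuous ((C2G.2 k i).1.1 (xpart x k, pw p k)).
apply: cvgB.
  apply: (cvg_comp (fun n => (xpart (xx n) k, pw (pp n) k)) (Defs.cst i)
    (cvg_pair (submxrow_cvg U _ _ k cx) (submxrow_cvg U _ _ k cw))).
  exact: dg.
exact: (row_coord_cvg U _ _ i (submxrow_cvg U _ _ k cu)).
Qed.

Lemma equality_direction (k : 'I_N) (i : 'I_(ncst G k)) : (i < neq G k)%N ->
  dot (gradg p x i) (xpart y k) = 0.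
Proof.
move=> ik; have qs := slack_quotient_cvg k i.
have [_ eq0 _] := sol k.
have E : (fun n => (t n)^-1 * (slack (pp n) (xx n) i - slack p x i)) = (fun=> 0).
  apply/funext => n; have [_ eqn _] := sols n k.
  have sn : slack (pp n) (xx n) i = 0 := eqn i ik.
  by rewrite sn (eq0 i ik : slack p x i = 0) subrr mulr0.
by rewrite E in qs; rewrite (cvg_unique _ qs (cvg_cst 0)).
Qed.

Lemma inequality_direction (k : 'I_N) (i : 'I_(ncst G k)) : (neq G k <= i)%N ->
  [/\ 0 < mpart l k ord0 i -> dot (gradg p x i) (xpart y k) = 0,
      slack p x i < 0 -> mpart mu k ord0 i = 0,
      mpart l k ord0 i = 0 -> slack p x i = 0 ->
        0 <= mpart mu k ord0 i /\ dot (gradg p x i) (xpart y k) <= 0 &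
      mpart mu k ord0 i * dot (gradg p x i) (xpart y k) = 0].
Proof.
move=> ik; apply: (complementarity_limit U t _ _ _ _ _ _ t0
  (multiplier_quotient_cvg k i) (slack_quotient_cvg k i)).
- exact: (row_coord_cvg U _ _ i (submxrow_cvg U _ _ k cl)).
- exact: slack_cvg.
- by move=> n; have [_ _ /(_ i ik)] := sols n k.
- by have [_ _ /(_ i ik)] := sol k.
Qed.

Lemma limit_critical : critical_cone p x l y.
Proof.
move=> k; split=> i; rewrite inE.
  move=> /orP[ik|/and3P[ik l0 _]]; first exact: equality_direction.
  by have [/(_ l0)] := inequality_direction k i ik.
move=> /and3P[ik /eqP l0 /eqP s0].
by have [_ _ /(_ l0 s0)[]] := inequality_direction k i ik.
Qed.

Lemma limit_complementarity (k : 'I_N) (i : 'I_(ncst G k)) :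
  mpart mu k ord0 i * dot (gradg p x i) (xpart y k) = 0.
Proof.
have [ik|ik] := ltnP i (neq G k); first by rewrite equality_direction // mulr0.
by have [] := inequality_direction k i ik.
Qed.

(** Outside [I1] only inequalities remain. A negative slack kills [mu]; a zero slack forces a zero
    multiplier, so the index lies in [I2] and [mu] is a limit of nonnegative quotients. *)
Lemma limit_multiplier_sign (k : 'I_N) (i : 'I_(ncst G k)) : i \notin I1 p x l (k:=k) ->
  (i \in I2 p x l (k:=k) -> 0 <= mpart mu k ord0 i) /\
  (i \notin I2 p x l (k:=k) -> mpart mu k ord0 i = 0).
Proof.
rewrite !inE negb_or -leqNgt => /andP[ik]; rewrite ik /=.
have [_ m0 deg _] := inequality_direction k i ik.
have [_ _ /(_ i ik)[/= l0 s0 ls0]] := sol k.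
rewrite -/(slack p x i) in s0 ls0.
have [s00|s00] := eqVneq (slack p x i) 0; last first.
  by move=> _; rewrite andbF; split=> // _; apply: m0; rewrite lt_neqAle s00.
rewrite !andbT lt_neqAle l0 andbT negbK => /eqP l00.
by rewrite -l00 eqxx; split=> // _; case: (deg (esym l00) s00).
Qed.

(** * Vanishing of the limit direction *)

Hypothesis IP : I_property p x l.
Hypothesis MF : forall k, SMFCQ p x l k.

Lemma limit_profile_eq0 : y = 0.
Proof.
apply: IP; first exact: limit_critical.
move=> k; rewrite hess_lagrangian_form // [X in X%:M](_ : _ = 0) ?raddf0 //.
under eq_bigr => a _.
  rewrite (_ : lagrangian_diff2 _ _ _ _ _ _ =
    - \sum_j mpart mu k ord0 j * gradg p x j ord0 a); last first.
    by apply/eqP; rewrite -addr_eq0 stationarity_limit.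
  rewrite mulrN mulr_sumr; over.
(* After the exchange of sums, constraint j contributes [mu_j] times the pairing of its gradient
   with [y^k], which is 0 by complementarity. *)
rewrite sumrN exchange_big /= big1 ?oppr0 // => j _.
rewrite -[RHS](limit_complementarity k j) mulr_sumr.
by apply: eq_bigr => a _; rewrite mulrCA [_ * gradg _ _ _ _ _]mulrC.
Qed.

Lemma limit_multiplier_eq0 : mu = 0.
Proof.
have st k a : \sum_j mpart mu k ord0 j * gradg p x j ord0 a = 0.
  have := stationarity_limit k a; rewrite limit_profile_eq0.
  have lin := weighted_diff_linear k (mpart l k) (pw p k).
  rewrite (_ : lagrangian_diff2 _ _ _ _ _ _ = 0) ?add0r //.
  (* Linearity with scalar -1 at the zero vectors gives F(0) = - F(0) + F(0) = 0, which removes the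
     Hessian term. *)
  have := lin (fun z => 'd (@cost R N G k) z (evec a, 0))
    (fun j z => 'd (@Defs.cst R N G k j) z (xpart (evec a) k, 0)) x (-1) 0 0.
  by rewrite scaler0 addr0 scaleN1r addNr.
suff mu0 k j : mpart mu k ord0 j = 0.
  rewrite [mu]row_block_sum; apply: big1 => k _; apply: big1 => j _.
  by rewrite [X in X *: _]mu0 scale0r.
have [fr [z [z1 z2]]] := MF k.
have sz : \sum_j mpart mu k ord0 j * dot (gradg p x j) z = 0.
  transitivity (\sum_a (\sum_j mpart mu k ord0 j * gradg p x j ord0 a) * z ord0 a);
    last by rewrite big1 // => a _; rewrite st mul0r.
  under [RHS]eq_bigr => a _ do rewrite mulr_suml.
  rewrite [RHS]exchange_big /=; apply: eq_bigr => i _.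
  by rewrite mulr_sumr; apply: eq_bigr => a _; rewrite mulrA.
(* The pairing with [z] vanishes on [I1]; on [I2] a nonnegative [mu] meets a negative pairing;
   elsewhere [mu] is 0. *)
have le0 i : mpart mu k ord0 i * dot (gradg p x i) z <= 0.
  have [/z1 ->|/limit_multiplier_sign[m2 m0]] := boolP (i \in I1 p x l (k:=k)).
    by rewrite mulr0.
  have [i2|/m0 ->] := boolP (i \in I2 p x l (k:=k)); last by rewrite mul0r.
  by rewrite mulr_ge0_le0 ?m2 // ltW ?z2.
have mu2 i : i \notin I1 p x l (k:=k) -> mpart mu k ord0 i = 0.
  move=> /limit_multiplier_sign[_ m0].
  have [/z2 dz|/m0 //] := boolP (i \in I2 p x l (k:=k)).
  (* Terms of one sign with sum 0 vanish individually, and on [I2] the pairing with [z] is strictly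
     negative, so [mu] must be 0. *)
  have : \sum_j - (mpart mu k ord0 j * dot (gradg p x j) z) == 0.
    by rewrite sumrN sz oppr0.
  rewrite psumr_eq0 => [/allP/(_ i (mem_index_enum _))|a _]; last first.
    by rewrite oppr_ge0.
  by rewrite /= oppr_eq0 mulf_eq0 (lt_eqF dz) orbF => /eqP.
have [jI|] := boolP (j \in I1 p x l (k:=k)); last exact: mu2.
have frk := free_image_coef _ _ (fun j => mpart mu k ord0 j) fr.
apply: frk jI.
(* Stationarity is now a vanishing combination of gradients; with [mu] zero off [I1], it involves
   only the linearly independent ones. *)
have gs : \sum_j mpart mu k ord0 j *: gradg p x j = 0.
  by apply/rowP => a; rewrite summxE mxE -[RHS](st k a);
    apply: eq_bigr => i _; rewrite mxE.
rewrite (bigID (mem (I1 p x l (k:=k)))) /= [X in _ + X]big1 ?addr0 // in gs.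
by move=> i /mu2 ->; rewrite scale0r.
Qed.

End Linearization.

(** * Euclidean estimates and the contradiction argument *)

Lemma dot_ge0 {R : realType} {n : nat} (v : 'rV[R]_n) : 0 <= dot v v.
Proof. by apply: sumr_ge0 => i _; rewrite -expr2 sqr_ge0. Qed.

Lemma dotZZ {R : realType} {n : nat} (s : R) (v : 'rV[R]_n) :
  dot (s *: v) (s *: v) = s ^+ 2 * dot v v.
Proof.
by rewrite /dot mulr_sumr; apply: eq_bigr => i _; rewrite !mxE mulrACA expr2.
Qed.

(** Each squared coordinate is at most [dot v v]. This bridges the max norm, used for convergence,
    and the Euclidean norms of the calmness estimate. *)
Lemma norm_le_sqrt {R : realType} {n : nat} (v : 'rV[R]_n) (c : R) :
  dot v v <= c -> `|v| <= Num.sqrt c.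
Proof.
move=> vc; rewrite [leLHS]/Num.norm /= mx_normrE.
apply: bigmax_le => [|[i j] _ /=]; first exact: sqrtr_ge0.
rewrite ord1 -sqrtr_sqr ler_wsqrtr // (le_trans _ vc) //.
rewrite /dot (bigD1 j) //= -expr2 lerDl.
by apply: sumr_ge0 => a _; rewrite -expr2 sqr_ge0.
Qed.

Theorem theorem5p1 (R : realType) (N : nat) (G : nep R N)
    (p : param G) (x : profile G) (l : multiplier G) :
  nep_C2 G ->
  SKKT p (x, l) ->
  (forall k : 'I_N, SMFCQ p x l k) ->
  I_property p x l ->
  isolated_calm (@param_norm R N G) (@solution_norm R N G)
    (@SKKT R N G) p (x, l).
Proof.
move=> C2G sol MF IP; split => //; apply: contrapT => ncalm.
have bad (n : nat) : exists q : param G * solution G,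
    [/\ SKKT q.1 q.2, ball p n.+1%:R^-1 q.1, ball (x, l) n.+1%:R^-1 q.2 &
      n.+1%:R * param_norm (q.1 - p) < solution_norm (q.2 - (x, l))].
  (* Without such a pair, calmness would hold with constant n + 1 on the balls of radius 1 / (n +
     1). *)
  apply: contrapT => nq; apply: ncalm; exists n.+1%:R; split=> //.
  exists (ball p n.+1%:R^-1), (ball ((x, l) : solution G) n.+1%:R^-1).
  have n0 : 0 < n.+1%:R^-1 :> R by rewrite invr_gt0.
  split; [exact: ball_open|exact: ballxx|exact: ball_open|exact: ballxx|].
  move=> a Ba z [Sz Bz] /=; rewrite leNgt; apply/negP => lt.
  by apply: nq; exists (a, z).
have [q qP] := choice bad.
pose t n := solution_norm ((q n).2 - (x, l)).
have tgt n : n.+1%:R * param_norm ((q n).1 - p) < t n by have [] := qP n.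
have t0 n : 0 < t n.
  (* The strict inequality in the failure of calmness is what makes division by [t n] legitimate. *)
  by apply: le_lt_trans (tgt n); rewrite mulr_ge0 // sqrtr_ge0.
have sols n : SKKT (q n).1 ((q n).2.1, (q n).2.2).
  by rewrite -surjective_pairing; have [] := qP n.
(* One ultrafilter finer than [\oo] serves for the profile and the multiplier quotients
   simultaneously. *)
have [U [UU sU]] := ultraFilterLemma (F := \oo) _.
have inv0 (e : R) : 0 < e -> \forall n \near U, n.+1%:R^-1 < e.
  by move=> e0; apply: sU; exact: near_infty_natSinv_lt (PosNum e0).
have cp : (fun n => (q n).1) @ U --> p.
  apply/cvg_ballP => e /inv0; apply: filterS => n ne.
  by have [_ + _ _] := qP n; apply: le_ball; exact: ltW.
have cz : (fun n => (q n).2) @ U --> ((x, l) : solution G).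
  apply/cvg_ballP => e /inv0; apply: filterS => n ne.
  by have [_ _ + _] := qP n; apply: le_ball; exact: ltW.
have bounded m (v : nat -> 'rV[R]_m) : (forall n, dot (v n) (v n) <= t n ^+ 2) ->
    exists w : 'rV[R]_m, (fun n => (t n)^-1 *: v n) @ U --> w.
  move=> vt; apply: (ultra_compact_cvg U (fun n => (t n)^-1 *: v n) _ UU
    (unit_ball_compact m)) => n /=.
  rewrite normrZ gtr0_norm ?invr_gt0 // mulrC ler_pdivrMr // mul1r.
  by rewrite -[leRHS]gtr0_norm // -sqrtr_sqr norm_le_sqrt.
(* Since [|p_n - p| < t n / (n + 1)], the quotient has norm at most 1 / (n + 1). *)
have negligible m (v : nat -> 'rV[R]_m) :
    (forall n, `|v n| <= param_norm ((q n).1 - p)) ->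
    (fun n => (t n)^-1 *: v n) @ U --> (0 : 'rV[R]_m).
  move=> vp; apply/cvgr0Pnorm_le => e /inv0; apply: filterS => n ne.
  rewrite normrZ gtr0_norm ?invr_gt0 // mulrC ler_pdivrMr //.
  apply: (le_trans (vp n)); apply: (@le_trans _ _ (n.+1%:R^-1 * t n)).
    by rewrite ler_pdivlMl // ltW.
  by apply: ler_wpM2r; exact: ltW.
have t2 n : t n ^+ 2 = dot ((q n).2.1 - x) ((q n).2.1 - x)
                     + dot ((q n).2.2 - l) ((q n).2.2 - l).
  by rewrite sqr_sqrtr // addr_ge0 ?dot_ge0.
have [y qx] : exists y : profile G,
    (fun n => (t n)^-1 *: ((q n).2.1 - x)) @ U --> y.
  by apply: bounded => n; rewrite t2 lerDl dot_ge0.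
have [mu ql] : exists mu : multiplier G,
    (fun n => (t n)^-1 *: ((q n).2.2 - l)) @ U --> mu.
  by apply: bounded => n; rewrite t2 lerDr dot_ge0.
(* The normalized increments have Euclidean length exactly 1 for every n, and [dot] is
   continuous. *)
have lim1 : dot y y + dot mu mu = 1.
  have one : (fun n =>
      dot ((t n)^-1 *: ((q n).2.1 - x)) ((t n)^-1 *: ((q n).2.1 - x))
      + dot ((t n)^-1 *: ((q n).2.2 - l)) ((t n)^-1 *: ((q n).2.2 - l))) @ U
    --> (1 : R).
    apply: cvg_near_cst; apply: nearW => n.
    by rewrite !dotZZ -mulrDr -t2 exprVn mulVf // expf_neq0 // gt_eqF.
  apply: (cvg_unique _ _ one) => //.
  by apply: cvgD; apply: dot_cvg.
have cu : (fun n => (q n).1.1.1) @ U --> p.1.1.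
  exact: (cvg_comp _ _ (cvg_comp _ _ cp (@cvg_fst _ _ _ _ _)) (@cvg_fst _ _ _ _ _)).
have cw : (fun n => (q n).1.2) @ U --> p.2.
  exact: (cvg_comp _ _ cp (@cvg_snd _ _ _ _ _)).
have cx : (fun n => (q n).2.1) @ U --> x.
  exact: (cvg_comp _ _ cz (@cvg_fst _ _ _ _ _)).
have cl : (fun n => (q n).2.2) @ U --> l.
  exact: (cvg_comp _ _ cz (@cvg_snd _ _ _ _ _)).
have qu :
    (fun n => (t n)^-1 *: ((q n).1.1.1 - p.1.1)) @ U --> (0 : multiplier G).
  apply: negligible => n; apply: norm_le_sqrt.
  by rewrite -addrA lerDl addr_ge0 ?dot_ge0.
have qv : (fun n => (t n)^-1 *: ((q n).1.1.2 - p.1.2)) @ U --> (0 : profile G).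
  apply: negligible => n; apply: norm_le_sqrt.
  by rewrite addrAC lerDr addr_ge0 ?dot_ge0.
have qw : (fun n => (t n)^-1 *: ((q n).1.2 - p.2)) @ U --> (0 : wparam G).
  apply: negligible => n; apply: norm_le_sqrt.
  by rewrite lerDr addr_ge0 ?dot_ge0.
have y0 : y = 0.
  exact: (limit_profile_eq0 U p x y l mu (fun n => (q n).1) (fun n => (q n).2.1)
    (fun n => (q n).2.2) t C2G sol sols t0 cu cw cx cl qu qv qw qx ql IP).
have mu0 : mu = 0.
  exact: (limit_multiplier_eq0 U p x y l mu (fun n => (q n).1) (fun n => (q n).2.1)
    (fun n => (q n).2.2) t C2G sol sols t0 cu cw cx cl qu qv qw qx ql IP MF).
have dot00 m : dot (0 : 'rV[R]_m) 0 = 0.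
  by rewrite /dot big1 // => i _; rewrite mxE mul0r.
by move: lim1; rewrite y0 mu0 !dot00 addr0 => /eqP; rewrite eq_sym oner_eq0.
Qed.
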